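(* Let $x=(x_1,\dots,x_{d+h})$ be a configuration with $d+h$ bodies in $\mathbb R^d$. Then $x$ is a central configuration of dimension $d$ if and only if $x$ satisfies the Laura-Andoyer equations $$L_{ijl_1\cdots l_h}=\sum_{t=1}^{h}(-1)^t\, m_{l_t}\,(R_{il_t}-R_{jl_t})\,\triangle_{l_1\cdots l_{t-1}l_{t+1}\cdots l_h}=0$$ for all pairwise distinct indices $i,j,l_1,\dots,l_h\in\{1,\dots,d+h\}$ with $i<j$ and $l_1<\dots<l_h$.
   Context: Here $d,h\ge1$ are integers and $a\in\mathbb R$ is the exponent of the homogeneous force law. The bodies have pairwise distinct positions $x_i\in\mathbb R^d$ and nonzero real masses $m_1,\dots,m_{d+h}$ with total mass $M=\sum_i m_i\neq0$. Write $r_{ij}=\|x_i-x_j\|$, $R_{ij}=r_{ij}^{2a}$, and $c=\frac1M\sum_i m_ix_i$. The configuration is central (for exponent $a$) if there is $\lambda\in\mathbb R$ such that $\sum_{j\neq i}m_jR_{ij}(x_j-x_i)=\lambda(x_i-c)$ for all $i$. It has dimension $d$ if the points $x_1,\dots,x_{d+h}$ affinely span $\mathbb R^d$. For indices $p_1<\dots<p_{h-1}$ in $\{1,\dots,d+h\}$, let $X_{p_1\cdots p_{h-1}}$ be the $(d+1)\times(d+1)$ matrix whose columns are $\binom{1}{x_p}$ for $p\notin\{p_1,\dots,p_{h-1}\}$, in increasing order of $p$, and set $$\triangle_{p_1\cdots p_{h-1}}=(-1)^{p_1+\dots+p_{h-1}}\det X_{p_1\cdots p_{h-1}}.$$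
   Formalization: It is assumed that the points affinely span R^d (otherwise all determinants vanish and the equations hold trivially), and that d≥2 or h=1 (for d=1, h≥2 there are no indices i,j,l_1,…,l_h, yet not every collinear configuration is central). *)

(* Defs.v *)
From mathcomp Require Import all_boot all_order all_algebra.
From mathcomp Require Import reals exp.
Set Implicit Arguments.
Unset Strict Implicit.
Unset Printing Implicit Defensive.
Import Order.TTheory GRing.Theory Num.Theory.
Local Open Scope ring_scope.

(* The library norm on matrices is the sup norm, hence this definition. *)
Definition enorm (R : realType) (d : nat) (u : 'cV[R]_d) : R :=
  Num.sqrt (\sum_(k < d) u k 0 ^+ 2).

Section Configurations.
Variables (R : realType) (d n : nat).
Implicit Types (a : R) (m : 'I_n -> R) (x : 'I_n -> 'cV[R]_d).

Definition dist x (i j : 'I_n) : R := enorm (x i - x j).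

Definition Rpow a x (i j : 'I_n) : R := dist x i j `^ (2 * a).

Definition total_mass m : R := \sum_i m i.

Definition center_of_mass m x : 'cV[R]_d :=
  (total_mass m)^-1 *: \sum_i m i *: x i.

Definition central a m x : Prop :=
  exists lambda : R, forall i : 'I_n,
    \sum_(j < n | j != i) (m j * Rpow a x i j) *: (x j - x i)
      = lambda *: (x i - center_of_mass m x).

Definition affinely_spans x : Prop :=
  forall y : 'cV[R]_d, exists w : 'I_n -> R,
    \sum_i w i = 1 /\ \sum_i w i *: x i = y.

Definition central_of_full_dim a m x : Prop :=
  central a m x /\ affinely_spans x.

(* [enum] lists ordinals in increasing order. The default column 0 of [nth] is
   never used when #|P| = n - d.+1. *)
Definition Xmx x (P : {set 'I_n}) : 'M[R]_(1 + d) :=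
  \matrix_(r, k)
    (nth 0 [seq col_mx (1%:M : 'M_1) (x p) | p <- enum (~: P)] k) r 0.

(* Bodies are numbered from 0 here: the 1-based index of p is p.+1. *)
Definition triangle x (P : {set 'I_n}) : R :=
  (-1) ^+ (\sum_(p in P) p.+1)%N * \det (Xmx x P).

Definition LauraAndoyer a m x (h : nat) (i j : 'I_n) (l : 'I_h -> 'I_n) : R :=
  \sum_(t < h) (-1) ^+ t.+1 * m (l t)
     * (Rpow a x i (l t) - Rpow a x j (l t))
     * triangle x [set l s | s : 'I_h & s != t].

End Configurations.

(* Main.v *)
(* Lift the bodies to y_k = (1; x_k) in R^(d+1) and put
     W_ij = sum_(k <> i, j) m_k (R_ik - R_jk) y_k.
   Expanding each determinant along the column of y_(l_t), the left-hand side
   L_{i j l} is, up to a sign depending only on l, the determinant of W_ij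
   followed by the y_k with k outside l. As i and j are outside l and the y_k span
   R^(d+1), all the L_{i j l} with i, j fixed vanish iff W_ij is in the span of
   y_i and y_j, i.e. iff the difference of the accelerations of bodies i and j is
   parallel to x_i - x_j. The multipliers agree on every non-collinear triple,
   hence are all equal since d >= 2, and conservation of momentum turns
   A_i - A_j = lambda (x_i - x_j) into A_i = lambda (x_i - c). *)
Require Import Defs.
From mathcomp Require Import all_boot all_order all_algebra.
From mathcomp Require Import reals exp.
From mathcomp Require Import ssrAC ring zify.
Set Implicit Arguments.
Unset Strict Implicit.
Unset Printing Implicit Defensive.
Import Order.TTheory GRing.Theory Num.Theory.
Local Open Scope ring_scope.

(** * Increasing enumeration of sets of indices *)

Lemma enum_ord_sorted (n : nat) (A : {set 'I_n}) :
  sorted (fun i j : 'I_n => i < j)%N (enum A).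
Proof.
have trans : transitive (fun i j : 'I_n => i < j)%N.
  by move=> j i k; exact: ltn_trans.
rewrite {1}/enum_mem sorted_filter // -enumT.
rewrite -[sorted _ _]/(sorted (relpre val ltn) (enum 'I_n)) -sorted_map.
by rewrite val_enum_ord iota_ltn_sorted.
Qed.

(** As [enum] is increasing, [p] comes right after the elements of [K] below it. Their number gives
    the sign of the Laplace expansion along the column of [p]. *)
Lemma enum_setU1 (n : nat) (p : 'I_n) (K : {set 'I_n}) : p \notin K ->
  exists e1 e2, [/\ enum (p |: K) = e1 ++ p :: e2, enum K = e1 ++ e2
    & size e1 = #|[set k in K | (k < p)%N]| ].
Proof.
move=> pK.
have pin : p \in enum (p |: K) by rewrite mem_enum setU11.
have sK := enum_ord_sorted (p |: K).
have uK := enum_uniq (p |: K).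
have eK : enum K = [seq k <- enum (p |: K) | k != p].
  rewrite /enum_mem -filter_predI; apply: eq_filter => k /=.
  by rewrite !inE; case: eqP => [->|] //=; rewrite (negPf pK).
case/splitPr def_e : _ / pin sK uK eK => [e1 e2] sK uK eK.
have trans : transitive (fun i j : 'I_n => i < j)%N.
  by move=> j i k; exact: ltn_trans.
move: uK; rewrite cat_uniq /= negb_or => /and4P [_ /andP[p1 _] p2 _].
have ee : enum K = e1 ++ e2.
  rewrite eK filter_cat /= eqxx /=; congr (_ ++ _); apply/all_filterP/allP => k.
    by move=> k1; apply: contraNneq p1 => <-.
  by move=> k2; apply: contraNneq p2 => <-.
exists e1, e2; split => //.
move: sK; rewrite sorted_pairwise // pairwise_cat /= => /and4P[].
move=> /allrelP lt1 _ /allP lt2 _.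
have -> : #|[set k in K | (k < p)%N]| = count (fun k : 'I_n => k < p)%N (enum K).
  rewrite cardE -size_filter /enum_mem -filter_predI; congr size.
  by apply: eq_filter => k; rewrite !inE andbC.
rewrite ee count_cat.
have : all (fun k : 'I_n => k < p)%N e1.
  by apply/allP => k k1; apply: lt1; rewrite ?inE ?eqxx.
rewrite all_count => /eqP ->.
suff -> : count (fun k : 'I_n => k < p)%N e2 = 0%N by rewrite addn0.
apply/eqP; rewrite -leqn0 leqNgt -has_count; apply/hasPn => k k2.
by rewrite -leqNgt ltnW // lt2.
Qed.

Lemma superset_card (T : finType) (A : {set T}) (k : nat) :
  (#|A| <= k <= #|T|)%N -> exists2 B : {set T}, A \subset B & #|B| = k.
Proof.
case/andP=> leAk lekT; have [r] := ubnP (k - #|A|)%N.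
elim: r A leAk => // r IHr A leAk lt_r.
have [<-|neAk] := eqVneq #|A| k; first by exists A.
have ltAk : (#|A| < k)%N by rewrite ltn_neqAle neAk.
have /properP [_ [p _ pA]] : A \proper [set: T].
  by rewrite properEcard subsetT cardsT (leq_trans ltAk).
have cpA : #|p |: A| = #|A|.+1 by rewrite cardsU1 pA.
have [||B sAB cB] := IHr (p |: A); rewrite ?cpA //.
  by rewrite subnS -ltnS prednK ?subn_gt0.
by exists B; rewrite // (subset_trans _ sAB) // subsetUr.
Qed.

(** * Cofactor forms and determinants with a marked column *)

(** The width [k] is meant to be [#|K|] but kept free, so that the type does not depend on [K]; the
    default column of [nth] is then never read. *)
Definition colsmx (R : comNzRingType) (D n k : nat) (y : 'I_n -> 'cV[R]_D)
    (K : {set 'I_n}) : 'M[R]_(D, k) :=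
  \matrix_(r, c) (nth 0 [seq y p | p <- enum K] c) r 0.

(** The generalised cross product of the columns of [N]: its product with [v] is the determinant of
    [v] followed by [N]. *)
Definition cofactor_form (R : comNzRingType) (d : nat) (N : 'M[R]_(d.+1, d)) :
    'rV[R]_d.+1 :=
  \row_r ((-1) ^+ r * \det (row' r N)).

Lemma det_cofactor_form (R : comNzRingType) (d : nat) (N : 'M[R]_d.+1)
    (q : 'I_d.+1) :
  \det N = (-1) ^+ q * (cofactor_form (col' q N) *m col q N) 0 0.
Proof.
rewrite (expand_det_col N q) mxE mulr_sumr; apply: eq_bigr => r _.
by rewrite !mxE /cofactor exprD mulrC; ring.
Qed.

Lemma det_row_mx_cofactor (R : comNzRingType) (d : nat) (v : 'cV[R]_d.+1)
    (N : 'M[R]_(d.+1, d)) :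
  \det (row_mx v N : 'M_d.+1) = (cofactor_form N *m v) 0 0.
Proof.
rewrite (det_cofactor_form _ 0) expr0 mul1r.
have -> : col 0 (row_mx v N : 'M_d.+1) = v.
  apply/matrixP => r c; rewrite mxE ord1 -[LHS]/(row_mx v N r _).
  by rewrite (_ : 0 = lshift d (0 : 'I_1)) ?row_mxEl //; apply: val_inj.
congr ((cofactor_form _ *m v) 0 0).
apply/matrixP => r c; rewrite mxE -[LHS]/(row_mx v N r _).
by rewrite (_ : lift 0 c = rshift 1 c) ?row_mxEr //; apply: val_inj.
Qed.

Lemma det_colsmx_setU1 (R : comNzRingType) (d n : nat) (y : 'I_n -> 'cV[R]_d.+1)
    (K : {set 'I_n}) (p : 'I_n) : p \notin K -> #|K| = d ->
  \det (colsmx d.+1 y (p |: K)) =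
  (-1) ^+ #|[set k in K | (k < p)%N]| * (cofactor_form (colsmx d y K) *m y p) 0 0.
Proof.
move=> pK cK; have [e1 [e2 [eU eK <-]]] := enum_setU1 pK.
have lt_e1 : (size e1 < d.+1)%N.
  by rewrite ltnS -cK cardE eK size_cat leq_addr.
rewrite (det_cofactor_form _ (Ordinal lt_e1)) /=; congr (_ * (cofactor_form _ *m _) 0 0).
  apply/matrixP => r c; rewrite !mxE eU eK !map_cat !nth_cat !size_map /= /bump.
  case: (leqP (size e1) c) => [le1c|lt1c] /=; last by rewrite add0n lt1c.
  by rewrite add1n ltnNge (leq_trans le1c) //= subSn // [in RHS]ltnNge le1c.
apply/matrixP => r c.
by rewrite !mxE eU map_cat nth_cat size_map /= ltnn subnn /= ord1.
Qed.

(** Placing [y k] in front of the columns of [K] repeats a column, so the determinant vanishes. *)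
Lemma cofactor_form_colsmx0 (R : comNzRingType) (d n : nat)
    (y : 'I_n -> 'cV[R]_d.+1) (K : {set 'I_n}) (k : 'I_n) :
  k \in K -> #|K| = d -> (cofactor_form (colsmx d y K) *m y k) 0 0 = 0.
Proof.
move=> kK cK; rewrite -det_row_mx_cofactor -det_tr.
have lt_k : (index k (enum K) < d)%N by rewrite -cK cardE index_mem mem_enum.
apply: (@determinant_alternate _ _ _ 0 (rshift 1 (Ordinal lt_k))) => [//|c].
rewrite [LHS]mxE [RHS]mxE -[LHS]/(row_mx _ _ c _) (_ : 0 = lshift d (0 : 'I_1)); last exact: val_inj.
rewrite row_mxEl -[RHS]/(row_mx _ _ c _) row_mxEr mxE (nth_map k) /= ?nth_index ?mem_enum //.
by rewrite -cardE cK.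
Qed.

(** * Homogeneous coordinates and the sign of a Laura-Andoyer sum *)

(** The height is written [d.+1], convertible to [1 + d], to suit square determinants; block lemmas
    are therefore applied with explicit sizes. *)
Definition aug (R : nzRingType) (d : nat) (u : 'cV[R]_d) : 'cV[R]_d.+1 :=
  col_mx (1%:M : 'M_1) u.

Section Increasing.
Variables (n h : nat) (l : 'I_h -> 'I_n).
Hypothesis l_incr : forall s t : 'I_h, (s < t)%N -> (l s < l t)%N.

Lemma incr_ltn (s t : 'I_h) : (l s < l t)%N = (s < t)%N.
Proof.
apply/idP/idP => [lt_l|/l_incr //]; rewrite ltnNge; apply/negP.
rewrite leq_eqVlt => /orP[/eqP/val_inj eq_ts|/l_incr lt_l'].
  by rewrite eq_ts ltnn in lt_l.
by have := ltn_trans lt_l lt_l'; rewrite ltnn.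
Qed.

Lemma incr_inj : injective l.
Proof.
move=> s t eq_l; apply: val_inj => /=.
by case: (ltngtP s t) => //; rewrite -incr_ltn eq_l ltnn.
Qed.

(** The indices below [l t] are those outside the image of [l] together with the [l s] for
    [s < t]. *)
Lemma incr_rank (t : 'I_h) :
  (#|[set k in ~: [set l s | s : 'I_h] | (k < l t)%N]| + t)%N = l t.
Proof.
have card_lt (p : nat) (q : 'I_p) : #|[set k : 'I_p | (k < q)%N]| = q.
  have lt_qp := ltnW (ltn_ord q).
  have w_inj : injective (widen_ord lt_qp) by move=> u v [] /val_inj.
  transitivity #|[set widen_ord lt_qp u | u : 'I_q]|; last by rewrite card_imset ?card_ord.
  apply: eq_card => k; rewrite !inE; apply/idP/imsetP => [ltkq|[k' _ ->] /=].
    by exists (Ordinal ltkq) => //; apply: val_inj.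
  exact: ltn_ord.
rewrite -[RHS]card_lt -(card_lt h t) -(card_imset _ incr_inj) -cardsUI.
rewrite (_ : _ :&: _ = set0) ?cards0 ?addn0.
  apply: eq_card => k; rewrite !inE; have [/imsetP[s _ ->]|nk] /= := boolP (k \in _).
    rewrite incr_ltn; apply/imsetP/idP => [[s' ]|lts]; last by exists s; rewrite ?inE.
    by rewrite inE => lt_s' /incr_inj ->.
  rewrite orbC; case: imsetP => // -[s _ e]; case/imsetP: nk; by exists s.
apply/setP => k; rewrite !inE andbAC; apply/negP => /andP[/andP[nk /imsetP[s _ e]] _].
by case/imsetP: nk; exists s.
Qed.

End Increasing.

(** The columns of the [t]-th term are those of [K] and that of [l t]. By [incr_rank], the exponent
    [t.+1], the number of elements of [K] below [l t] and the sum over the other [l s] add up to an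
    exponent independent of [t], which factors out. *)
Lemma LauraAndoyerE (R : realType) (d h : nat) (a : R) (m : 'I_(d + h) -> R)
    (x : 'I_(d + h) -> 'cV[R]_d) (i j : 'I_(d + h)) (l : 'I_h -> 'I_(d + h)) :
  (forall s t : 'I_h, (s < t)%N -> (l s < l t)%N) ->
  LauraAndoyer a m x i j l =
  (-1) ^+ (\sum_t (l t).+1)%N *
  (cofactor_form (colsmx d (fun k => aug (x k)) (~: [set l t | t : 'I_h])) *m
   \sum_t (m (l t) * (Rpow a x i (l t) - Rpow a x j (l t))) *: aug (x (l t))) 0 0.
Proof.
move=> l_incr; set K := ~: _; set y := fun k => aug (x k).
have l_inj := incr_inj l_incr.
have cK : #|K| = d.
  by rewrite cardsCs setCK card_imset // !card_ord addnK.
rewrite mulmx_sumr summxE mulr_sumr; apply: eq_bigr => t _.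
rewrite -scalemxAr mxE /triangle.
have defP : ~: [set l s | s : 'I_h & s != t] = l t |: K.
  apply/setP => k; rewrite !inE; have [/imsetP[s _ ->]|nk] := boolP (k \in [set l s | s : 'I_h]).
    rewrite orbF; have [/l_inj <-|ne_l] := eqVneq (l s) (l t).
      by apply/imsetP => -[s']; rewrite inE => ne_s /l_inj e; rewrite e eqxx in ne_s.
    apply/negP/negP/imsetP; exists s => //; rewrite inE.
    by apply: contraNneq ne_l => ->.
  by rewrite orbT; apply: contra nk => /imsetP[s _ ->]; rewrite imset_f.
rewrite -[Xmx _ _]/(colsmx d.+1 y _) defP det_colsmx_setU1 //; last by rewrite !inE negbK imset_f.
rewrite big_imset /=; last by move=> s s' _ _ /l_inj.
rewrite [in RHS](bigD1 t) //= -[in RHS](incr_rank l_incr t) -/K.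
under eq_bigl do rewrite inE.
rewrite -addnS !exprD; ring.
Qed.

(** * Ranks and spans *)

(** Multiplication by [cokermx T] works modulo the row space of [T]. The rows of [Y] span this
    quotient, and [g] selects a basis of it among them. *)
Lemma extend_row_full (F : fieldType) (n q D : nat) (Y : 'M[F]_(n, D))
    (T : 'M[F]_(q, D)) : row_full Y ->
  exists (s : nat) (g : 'I_s -> 'I_n),
    (s + \rank T)%N = D /\ row_full (col_mx T (rowsub g Y)).
Proof.
move=> fullY; pose C := cokermx T; pose g := maxrankfun (Y *m C).
have rkC : \rank (Y *m C) = \rank C by rewrite eqmxMfull.
exists (\rank (Y *m C)), g; split.
  by rewrite rkC mxrank_coker subnK ?rank_leq_col.
have: (C <= rowsub g Y *m C)%MS.
  by rewrite mul_rowsub_mx eq_maxrowsub (eqmxMfull _ fullY).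
case/submxP => E defC.
(* What the chosen rows miss of the identity is killed by [cokermx T], so it lies in the row space
   of [T]. *)
have subT : (1%:M - E *m rowsub g Y <= T)%MS.
  by rewrite submxE mulmxBl mul1mx -mulmxA -defC subrr.
rewrite -sub1mx -(subrK (E *m rowsub g Y) 1%:M) addmx_sub //.
  by apply: submx_trans subT _; rewrite -addsmxE addsmxSl.
by apply: submx_trans (submxMl _ _) _; rewrite -addsmxE addsmxSr.
Qed.

Lemma sub_col_mx2P (F : fieldType) (D : nat) (u w v : 'cV[F]_D) :
  reflect (exists s t, v = s *: u + t *: w) (v^T <= col_mx u^T w^T)%MS.
Proof.
apply: (iffP idP) => [/submxP [E]|[s [t ->]]].
  rewrite -[E](@hsubmxK _ 1 1 1) mul_row_col [lsubmx E]mx11_scalar [rsubmx E]mx11_scalar.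
  rewrite !mul_scalar_mx -!linearZ -linearD => /trmx_inj ->.
  by exists (lsubmx E 0 0), (rsubmx E 0 0).
rewrite linearD !linearZ /= -addsmxE addmx_sub_adds ?scalemx_sub //.
Qed.

Lemma colsmx_sub (R : fieldType) (D n k : nat) (y : 'I_n -> 'cV[R]_D)
    (K : {set 'I_n}) (p : 'I_n) :
  p \in K -> #|K| = k -> ((y p)^T <= (colsmx k y K)^T)%MS.
Proof.
move=> pK cK.
have lt_p : (index p (enum K) < k)%N by rewrite -cK cardE index_mem mem_enum.
suff -> : (y p)^T = row (Ordinal lt_p) (colsmx k y K)^T by apply: row_sub.
apply/matrixP => r c; rewrite !mxE (nth_map p) ?nth_index ?mem_enum ?ord1 //.
by rewrite /= -cardE cK.
Qed.

(** By contraposition: if [W] is outside the span of [y i] and [y j], these three vectors are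
    completed to a basis by further [y k]. The indices involved fit in a set [K] of size [d], for
    which the determinant of [W] followed by [K] is nonzero. *)
Lemma span2_of_cofactor_form (F : fieldType) (d n : nat) (y : 'I_n -> 'cV[F]_d.+1)
    (i j : 'I_n) (W : 'cV[F]_d.+1) :
  row_full (\matrix_k (y k)^T) -> \rank (col_mx (y i)^T (y j)^T) = 2%N ->
  (forall K : {set 'I_n}, i \in K -> j \in K -> #|K| = d ->
     (cofactor_form (colsmx d y K) *m W) 0 0 = 0) ->
  exists s t, W = s *: y i + t *: y j.
Proof.
move=> fullY; set U := col_mx _ _ => rkU W0; apply/sub_col_mx2P; rewrite -/U.
apply/negPn/negP => nWU; pose T := col_mx W^T U.
have [s [g [rk_sT]]] := extend_row_full T fullY.
have {rk_sT nWU} le_sd : (s.+2 <= d)%N.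
  have : (U < T)%MS.
    rewrite ltmxE -[T]/(col_mx _ _) -addsmxE addsmxSr /=.
    by apply: contra nWU; apply: submx_trans; rewrite -addsmxE addsmxSl.
  by rewrite ltmxErank rkU => /andP[_]; move: rk_sT; lia.
have le_dn : (d <= #|'I_n|)%N.
  by rewrite card_ord -ltnS (leq_trans _ (leqnSn _)) // -[X in (X <= _)%N](eqP fullY) rank_leq_row.
(* Only the bound of [#|A|] by [s + 2], hence by [d], is established. Padding to exactly [d]
   elements preserves spanning and makes the matrix square. *)
pose A := i |: (j |: [set g t | t : 'I_s]).
have [|K sAK cK] := @superset_card _ A d.
  rewrite le_dn andbT (leq_trans _ le_sd) // !cardsU1.
  have : (#|[set g t | t : 'I_s]| <= s)%N.
    by rewrite (leq_trans (leq_imset_card _ _)) ?card_ord.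
  by do 2 case: (_ \notin _); lia.
have memA k : k \in A -> ((y k)^T <= (colsmx d y K)^T)%MS.
  by move=> /(subsetP sAK) kK; exact: colsmx_sub.
pose N := (row_mx W (colsmx d y K) : 'M_d.+1).
rewrite -sub1mx => full_TG.
have : (1%:M <= col_mx W^T (colsmx d y K)^T)%MS.
  apply: submx_trans full_TG _.
  rewrite -[T]/(col_mx _ (col_mx _ _)) !col_mx_sub -!addsmxE addsmxSl /=.
  rewrite !(submx_trans _ (addsmxSr _ _)) //.
  - apply/row_subP => t; rewrite row_rowsub rowK memA // !inE.
    by rewrite imset_f ?orbT.
  - by rewrite memA // !inE eqxx orbT.
  - by rewrite memA // !inE eqxx.
rewrite sub1mx -tr_row_mx -[row_full _]/(row_full N^T) row_full_unit unitmx_tr unitmxE -[N]/(row_mx W (colsmx d y K)) det_row_mx_cofactor.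
by rewrite W0 ?unitr0 // (subsetP sAK) // !inE eqxx ?orbT.
Qed.

Lemma scale_aug (R : nzRingType) (d : nat) (s : R) (u : 'cV[R]_d) :
  s *: aug u = col_mx s%:M (s *: u) :> 'cV_d.+1.
Proof. by rewrite -scalemx1; exact: (@scale_col_mx _ 1 d 1). Qed.

Lemma aug_row_full (R : realType) (d n : nat) (x : 'I_n -> 'cV[R]_d) :
  affinely_spans x -> row_full (\matrix_k (aug (x k))^T).
Proof.
move=> span_x; rewrite -sub1mx; apply/row_subP => r.
set Y := \matrix_k _; move: {r}(row r _) => v.
have affine_sub (w : 'I_n -> R) : ((\sum_k w k *: (aug (x k))^T)%R <= Y)%MS.
  apply: summx_sub => k _; apply: scalemx_sub.
  by rewrite -[X in (X <= _)%MS](rowK (fun k => (aug (x k))^T)) row_sub.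
have aug_sub (u : 'cV[R]_d) : ((aug u)^T <= Y)%MS.
  have [w [w1 <-]] := span_x u.
  rewrite -[aug _]/(col_mx _ _) -w1 raddf_sum.
  suff -> : col_mx (\sum_i (w i)%:M) (\sum_i w i *: x i) = \sum_i w i *: aug (x i) :> 'cV_(1 + d).
    by rewrite linear_sum; under eq_bigr do rewrite linearZ /=; exact: affine_sub.
  apply: esym; rewrite (eq_bigr (fun i => col_mx (w i)%:M (w i *: x i))).
    elim/big_rec3: _ => [|i u1 u2 u3 _ ->]; first exact/esym/col_mx0.
    exact: add_col_mx.
  by move=> i _; exact: scale_aug.
(* Lifts have top entry 1; a multiple of the lift of the origin corrects it. *)
have -> : v = (aug (dsubmx (v^T : 'cV_(1 + d))))^T
              + (v 0 0 - 1) *: (aug (0 : 'cV[R]_d))^T.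
  apply: trmx_inj; rewrite linearD linearZ /= !trmxK.
  rewrite -[v^T in LHS](@vsubmxK _ 1 d) scale_aug scaler0.
  apply: etrans _ (esym (@add_col_mx _ 1 d 1 _ _ _ _)); rewrite addr0; congr col_mx.
  rewrite [LHS]mx11_scalar -raddfD /= addrC subrK; congr _%:M.
  by rewrite !mxE; congr (v _ _); apply: val_inj.
exact: addmx_sub (aug_sub _) (scalemx_sub _ (aug_sub _)).
Qed.

Lemma aug_pair_rank (F : fieldType) (d : nat) (u v : 'cV[F]_d) :
  u != v -> \rank (col_mx (aug u)^T (aug v)^T) = 2%N.
Proof.
move=> ne_uv; apply/eqP; apply: inj_row_free => E.
rewrite -[E](@hsubmxK _ 1 1 1) mul_row_col [lsubmx E]mx11_scalar [rsubmx E]mx11_scalar.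
move: (lsubmx E 0 0) (rsubmx E 0 0) => s t.
rewrite !mul_scalar_mx -!linearZ -linearD -[0]trmx0 => /trmx_inj.
rewrite !scale_aug => e.
have [] := @eq_col_mx _ 1 d 1 _ _ _ _
  (etrans (esym (@add_col_mx _ 1 d 1 _ _ _ _)) (etrans e (esym (col_mx0 _ 1 d 1)))).
move=> /(congr1 (fun M : 'M_1 => M 0 0)); rewrite !mxE !mulr1n.
move=> /eqP; rewrite addr_eq0 => /eqP s_t /eqP.
rewrite s_t scaleNr addrC -scalerBr scaler_eq0 subr_eq0 [v == u]eq_sym (negPf ne_uv) orbF.
by move=> /eqP ->; rewrite oppr0 !raddf0 row_mx0.
Qed.

(** * Accelerations and conservation of momentum *)

Lemma dist_sym (R : realType) (d n : nat) (x : 'I_n -> 'cV[R]_d) (i j : 'I_n) :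
  dist x i j = dist x j i.
Proof.
rewrite /dist /enorm; congr Num.sqrt; apply: eq_bigr => k _.
by rewrite !mxE -sqrrN opprB.
Qed.

Lemma Rpow_sym (R : realType) (d n : nat) (a : R) (x : 'I_n -> 'cV[R]_d)
    (i j : 'I_n) : Rpow a x i j = Rpow a x j i.
Proof. by rewrite /Rpow dist_sym. Qed.

Definition accel (R : realType) (d n : nat) (a : R) (m : 'I_n -> R)
    (x : 'I_n -> 'cV[R]_d) (i : 'I_n) : 'cV[R]_d :=
  \sum_(j < n | j != i) (m j * Rpow a x i j) *: (x j - x i).

(** Mutual forces are opposite because [Rpow] is symmetric, so exchanging the two summations shows
    that the total equals its own negative. *)
Lemma total_momentum (R : realType) (d n : nat) (a : R) (m : 'I_n -> R)
    (x : 'I_n -> 'cV[R]_d) : \sum_i m i *: accel a m x i = 0.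
Proof.
set S := \sum_i _.
pose f i j := (m i * (m j * Rpow a x i j)) *: (x j - x i).
have defS : S = \sum_i \sum_j f i j.
  apply: eq_bigr => i _; rewrite scaler_sumr [RHS](bigD1 i) //=.
  rewrite [f i i](_ : _ = 0) ?add0r; last by rewrite /f (subrr (x i)) scaler0.
  by apply: eq_bigr => j _; rewrite scalerA.
have SN : S = - S.
  rewrite [in LHS]defS exchange_big defS -sumrN; apply: eq_bigr => i _.
  rewrite -sumrN; apply: eq_bigr => j _.
  by rewrite /f -scalerN opprB Rpow_sym mulrCA.
have : 2%:R *: S = 0 by rewrite scaler_nat mulr2n {1}SN addNr.
by move/eqP; rewrite scaler_eq0 pnatr_eq0 /= => /eqP.
Qed.

(** When the relations are summed with weights [m j], the total momentum vanishes, and dividing by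
    the total mass gives the equation of body [i0]. Those of the other bodies follow by
    subtraction. *)
Lemma central_accel (R : realType) (d n : nat) (a : R) (m : 'I_n -> R)
    (x : 'I_n -> 'cV[R]_d) (i0 : 'I_n) : total_mass m != 0 ->
  central a m x <->
  (exists lambda, forall j, accel a m x i0 - accel a m x j = lambda *: (x i0 - x j)).
Proof.
move=> M0; split=> [[lambda cen]|[lambda rel]]; exists lambda.
  by move=> j; rewrite /accel !cen -scalerBr opprB addrA subrK.
have acc0 : accel a m x i0 = lambda *: (x i0 - center_of_mass m x).
  apply: (scalerI M0); rewrite scalerA mulrC -scalerA scalerBr /center_of_mass.
  rewrite scalerA divff // scale1r /total_mass !scaler_suml -sumrB scaler_sumr.
  transitivity (\sum_j m j *: accel a m x i0 - \sum_j m j *: accel a m x j).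
    by rewrite total_momentum subr0.
  rewrite -sumrB; apply: eq_bigr => j _.
  by rewrite -!scalerBr rel scalerA mulrC -scalerA.
move=> j; rewrite -[LHS]/(accel a m x j).
have -> : accel a m x j = accel a m x i0 - lambda *: (x i0 - x j).
  by rewrite -rel opprB addrC subrK.
by rewrite acc0 -scalerBr opprB [X in _ *: X]addrC addrA subrK.
Qed.

(** * Laura-Andoyer sums as tests of parallelism *)

Definition cross_sum (R : realType) (d n : nat) (a : R) (m : 'I_n -> R)
    (x : 'I_n -> 'cV[R]_d) (i j : 'I_n) : 'cV[R]_d.+1 :=
  \sum_(k | (k != i) && (k != j)) (m k * (Rpow a x i k - Rpow a x j k)) *: aug (x k).

(** The terms [k = j] and [k = i] are split off from the two sums; what matters later is that they
    stay in the span of [y i] and [y j]. *)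
Lemma sum_rel_sub (R : pzRingType) (V : lmodType R) (I : finType)
    (c : I -> I -> R) (y : I -> V) (i j : I) : i != j ->
  \sum_(k | k != i) c i k *: (y k - y i) - \sum_(k | k != j) c j k *: (y k - y j) =
  \sum_(k | (k != i) && (k != j)) (c i k - c j k) *: y k
  + (- (\sum_(k | k != i) c i k) - c j i) *: y i
  + (c i j + \sum_(k | k != j) c j k) *: y j.
Proof.
move=> ne_ij.
have split_sum p q : p != q -> \sum_(k | k != p) c p k *: (y k - y p) =
    \sum_(k | (k != p) && (k != q)) c p k *: y k + c p q *: y q
    - (\sum_(k | k != p) c p k) *: y p.
  move=> ne_pq; under eq_bigr do rewrite scalerBr.
  rewrite sumrB -scaler_suml (bigD1 q) 1?eq_sym //=; congr (_ - _).
  by rewrite addrC.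
rewrite (split_sum i j) // (split_sum j i) 1?eq_sym //.
under [X in _ - (X + _ - _)]eq_bigl do rewrite andbC.
under [X in _ = X + _ + _]eq_bigr do rewrite scalerBl.
rewrite sumrB !scalerDl !scaleNr.
by rewrite !opprD opprK !addrA [LHS](ACl (1*4*3*5*2*6)).
Qed.

Lemma aug_sub (R : nzRingType) (d : nat) (u v : 'cV[R]_d) :
  aug u - aug v = col_mx (0 : 'M_1) (u - v) :> 'cV_d.+1.
Proof.
rewrite -scaleN1r scale_aug; apply: etrans (@add_col_mx _ 1 d 1 _ _ _ _) _.
by rewrite scaleN1r -raddfD /= subrr raddf0.
Qed.

(** Differences of lifts have top entry 0, so an acceleration with 0 on top is a linear combination
    of lifts, to which [sum_rel_sub] applies. *)
Lemma accel_sub_cross (R : realType) (d n : nat) (a : R) (m : 'I_n -> R)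
    (x : 'I_n -> 'cV[R]_d) (i j : 'I_n) : i != j ->
  exists s t, col_mx (0 : 'M_1) (accel a m x i - accel a m x j) =
    cross_sum a m x i j + s *: aug (x i) + t *: aug (x j) :> 'cV_d.+1.
Proof.
move=> ne_ij; pose c i k := m k * Rpow a x i k.
have lift_accel p : col_mx (0 : 'M_1) (accel a m x p) =
    \sum_(k | k != p) c p k *: (aug (x k) - aug (x p)) :> 'cV_d.+1.
  under eq_bigr do rewrite aug_sub.
  rewrite /accel; elim/big_rec2: _ => [|k u1 u2 _ <-]; first exact: (@col_mx0 _ 1 d 1).
  rewrite (@scale_col_mx _ 1 d 1) scaler0.
  by apply: esym; apply: etrans (@add_col_mx _ 1 d 1 _ _ _ _) _; rewrite addr0.
pose y k := aug (x k).
have := sum_rel_sub c y ne_ij; rewrite {}/y -!lift_accel => e.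
eexists; eexists; rewrite /cross_sum; under eq_bigr do rewrite mulrBr.
apply: etrans e; rewrite -[X in _ = _ + X]scaleN1r (@scale_col_mx _ 1 d 1).
by apply: etrans _ (esym (@add_col_mx _ 1 d 1 _ _ _ _)); rewrite scaler0 addr0 scaleN1r.
Qed.

(** The form kills the lifts of bodies outside [l], which are its own columns, so the sum over [l]
    extends to all bodies other than [i] and [j]. *)
Lemma LauraAndoyer_cross (R : realType) (d h : nat) (a : R) (m : 'I_(d + h) -> R)
    (x : 'I_(d + h) -> 'cV[R]_d) (i j : 'I_(d + h)) (l : 'I_h -> 'I_(d + h)) :
  (forall s t : 'I_h, (s < t)%N -> (l s < l t)%N) ->
  (forall t, l t != i /\ l t != j) ->
  LauraAndoyer a m x i j l =
  (-1) ^+ (\sum_t (l t).+1)%N *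
  (cofactor_form (colsmx d (fun k => aug (x k)) (~: [set l t | t : 'I_h])) *m
   cross_sum a m x i j) 0 0.
Proof.
move=> l_incr l_ij; rewrite LauraAndoyerE //; congr (_ * _).
have l_inj := incr_inj l_incr; set K := ~: _.
have cK : #|K| = d by rewrite cardsCs setCK card_imset // !card_ord addnK.
rewrite [cross_sum _ _ _ _ _](bigID (mem [set l t | t : 'I_h])) /= mulmxDr [RHS]mxE.
rewrite [X in _ = _ + X](_ : _ = 0) ?addr0.
  congr ((_ *m _) 0 0); pose G k := (m k * (Rpow a x i k - Rpow a x j k)) *: aug (x k).
  transitivity (\sum_(k in [set l t | t : 'I_h]) G k).
    by rewrite big_imset //; exact: in2W.
  apply: eq_bigl => k; rewrite andbC; have [/imsetP[t _ ->]|//] := boolP (k \in _).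
  by have [-> ->] := l_ij t.
rewrite mulmx_sumr summxE big1 // => k /andP[_ nk].
by rewrite -scalemxAr mxE cofactor_form_colsmx0 ?mulr0 // inE.
Qed.

Lemma LauraAndoyer_of_parallel (R : realType) (d h : nat) (a : R)
    (m : 'I_(d + h) -> R) (x : 'I_(d + h) -> 'cV[R]_d) (i j : 'I_(d + h))
    (l : 'I_h -> 'I_(d + h)) (lambda : R) :
  i != j -> accel a m x i - accel a m x j = lambda *: (x i - x j) ->
  (forall s t : 'I_h, (s < t)%N -> (l s < l t)%N) ->
  (forall t, l t != i /\ l t != j) ->
  LauraAndoyer a m x i j l = 0.
Proof.
move=> ne_ij par l_incr l_ij; rewrite LauraAndoyer_cross //; set K := ~: _.
have l_inj := incr_inj l_incr.
have cK : #|K| = d by rewrite cardsCs setCK card_imset // !card_ord addnK.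
have iK : i \in K by rewrite inE; apply/imsetP => -[t _ e]; case: (l_ij t); rewrite e eqxx.
have jK : j \in K by rewrite inE; apply/imsetP => -[t _ e]; case: (l_ij t); rewrite e eqxx.
have [s [t]] := accel_sub_cross a m x ne_ij.
rewrite par -[0](scaler0 _ lambda) -(@scale_col_mx _ 1 d 1) -aug_sub => eW.
have -> : cross_sum a m x i j =
    (lambda - s) *: aug (x i) + (- lambda - t) *: aug (x j).
  rewrite !scalerDl !scaleNr -[LHS](addrK (s *: aug (x i))).
  rewrite -[X in X - _ = _](addrK (t *: aug (x j))) -eW scalerBr.
  by rewrite !addrA [LHS](ACl (1*4*2*3)).
rewrite mulmxDr mxE -!scalemxAr [X in X + _]mxE [X in _ + X]mxE.
by rewrite !(cofactor_form_colsmx0 (fun k => aug (x k))) // !mulr0 addr0 mulr0.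
Qed.

(** Every [d]-element set containing [i] and [j] is the complement of the image of an increasing
    family, so the hypotheses supply all the tests of [span2_of_cofactor_form]. *)
Lemma parallel_of_LauraAndoyer (R : realType) (d h : nat) (a : R)
    (m : 'I_(d + h) -> R) (x : 'I_(d + h) -> 'cV[R]_d) (i j : 'I_(d + h)) :
  affinely_spans x -> x i != x j ->
  (forall l : 'I_h -> 'I_(d + h),
    (forall s t : 'I_h, (s < t)%N -> (l s < l t)%N) ->
    (forall t, l t != i /\ l t != j) -> LauraAndoyer a m x i j l = 0) ->
  exists lambda, accel a m x i - accel a m x j = lambda *: (x i - x j).
Proof.
move=> span_x ne_x LA0.
have ne_ij : i != j by apply: contraNneq ne_x => ->.
have [s [t eW]] : exists s t,
    cross_sum a m x i j = s *: aug (x i) + t *: aug (x j).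
  apply: (@span2_of_cofactor_form _ _ _ (fun k => aug (x k))).
  - exact: aug_row_full.
  - exact: aug_pair_rank.
  move=> K iK jK cK.
  have sz : size (enum (~: K)) = h by rewrite -cardE cardsCs setCK cK card_ord addKn.
  (* The default [i] is never reached, as the list has [h] elements. *)
  pose l (t : 'I_h) := nth i (enum (~: K)) t.
  have l_incr (s t : 'I_h) : (s < t)%N -> (l s < l t)%N.
    move=> lt_st; apply: (sorted_ltn_nth _ _ (enum_ord_sorted _)) => //.
    - by move=> u v w; exact: ltn_trans.
    - by rewrite inE sz.
    - by rewrite inE sz.
  have lK t : l t \in ~: K by rewrite -mem_enum mem_nth ?sz.
  have l_ij t : l t != i /\ l t != j.
    by have := lK t; rewrite inE => nK; split; apply: contraNneq nK => ->.
  have defK : ~: [set l t | t : 'I_h] = K.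
    apply/eqP; rewrite eq_sym eqEcard; apply/andP; split.
      rewrite -setCS setCK; apply/subsetP => _ /imsetP[t _ ->]; exact: lK.
    by rewrite cardsCs setCK card_imset ?card_ord ?addnK ?cK //; exact: incr_inj.
  have /eqP := LA0 l l_incr l_ij.
  by rewrite LauraAndoyer_cross // defK mulf_eq0 signr_eq0 /= => /eqP.
have [s' [t']] := accel_sub_cross a m x ne_ij.
have -> : cross_sum a m x i j + s' *: aug (x i) + t' *: aug (x j) =
    (s + s') *: aug (x i) + (t + t') *: aug (x j).
  by rewrite eW !scalerDl !addrA [LHS](ACl (1*3*2*4)).
rewrite !scale_aug => e.
(* The top entry 0 forces the coefficients of the two lifts to be opposite. *)
have [] := @eq_col_mx _ 1 d 1 _ _ _ _ (etrans e (@add_col_mx _ 1 d 1 _ _ _ _)).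
rewrite -raddfD /= => /(congr1 (fun M : 'M_1 => M 0 0)); rewrite !mxE mulr1n.
move=> /esym/eqP; rewrite addr_eq0 => /eqP ->.
by move=> ->; exists (- (t + t')); rewrite scalerBr !scaleNr opprK.
Qed.

(** * A single multiplier for all bodies *)

(** Otherwise all [x k - p] are multiples of [u]; as affine combinations of the [x k] reach every
    point, the whole space would have dimension at most 1. *)
Lemma exists_off_line (R : realType) (d n : nat) (x : 'I_n -> 'cV[R]_d)
    (p u : 'cV[R]_d) : (2 <= d)%N -> affinely_spans x ->
  exists k, forall s, x k - p != s *: u.
Proof.
move=> d2 span_x.
have [/existsP[k nk]|] := boolP [exists k, ~~ ((x k - p)^T <= u^T)%MS].
  exists k => s; apply: contraNneq nk => ->; rewrite linearZ; exact: scalemx_sub.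
rewrite negb_exists => /forallP line.
have : (1%:M <= u^T)%MS.
  apply/row_subP => r; move: {r}(row r _) => v.
  have [w [w1 ev]] := span_x (v^T + p).
  have -> : v = (\sum_k w k *: (x k - p))^T.
    apply: trmx_inj; rewrite trmxK; under eq_bigr do rewrite scalerBr.
    by rewrite sumrB -scaler_suml w1 scale1r ev addrK.
  rewrite linear_sum; apply: summx_sub => k _; rewrite linearZ scalemx_sub //.
  by move/negPn: (line k).
move/mxrankS; rewrite mxrank1 => le_d.
by have := leq_trans d2 (leq_trans le_d (rank_leq_row _)).
Qed.

(** Eliminating the accelerations leaves a linear relation between [xk - xi] and [xj - xi], whose
    coefficients [l3 - l2] and [l1 - l2] vanish by independence. *)
Lemma noncollinear_multiplier_eq (F : fieldType) (V : lmodType F)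
    (xi xj xk Ai Aj Ak : V) (l1 l2 l3 : F) :
  xi != xj -> (forall s, xk - xi != s *: (xj - xi)) ->
  Ai - Aj = l1 *: (xi - xj) -> Aj - Ak = l2 *: (xj - xk) ->
  Ai - Ak = l3 *: (xi - xk) -> l1 = l3.
Proof.
move=> ne_ij off e1 e2 e3.
have combine (u w : V) : l1 *: - u + l2 *: (u - w) = l3 *: - w ->
    (l3 - l2) *: w = (l1 - l2) *: u.
  rewrite !scalerN scalerBr !scalerBl => /(congr1 -%R).
  by rewrite opprD !opprK opprB addrA => <-; rewrite [LHS]addrAC addrK.
have e : (l3 - l2) *: (xk - xi) = (l1 - l2) *: (xj - xi).
  apply: combine; rewrite !opprB addrA subrK -e1 -e2 -e3.
  by rewrite addrA subrK.
have [e32|ne32] := eqVneq l3 l2; last first.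
  have /negP[] := off ((l3 - l2)^-1 * (l1 - l2)).
  by rewrite -scalerA -e scalerA mulVf ?scale1r // subr_eq0.
move/esym/eqP: e; rewrite e32 subrr scale0r scaler_eq0 !subr_eq0.
by rewrite [xj == xi]eq_sym (negPf ne_ij) orbF => /eqP.
Qed.

(** A reference body [j0] fixes the multiplier. A body off the line through [x i0] and [x j0] is
    compared with [j0] directly, one on this line through a third body off it. *)
Lemma common_multiplier (R : realType) (d n : nat) (x A : 'I_n -> 'cV[R]_d)
    (i0 : 'I_n) : (2 <= d)%N -> injective x -> affinely_spans x ->
  (forall i j, i != j -> exists lambda, A i - A j = lambda *: (x i - x j)) ->
  exists lambda, forall j, A i0 - A j = lambda *: (x i0 - x j).
Proof.
move=> d2 inj_x span_x par.
have multiplier_eq j k (lj lk : R) : j != i0 ->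
    (forall s, x k - x i0 != s *: (x j - x i0)) ->
    A i0 - A j = lj *: (x i0 - x j) -> A i0 - A k = lk *: (x i0 - x k) -> lj = lk.
  move=> ne_j off ej ek.
  have [|l e] := par j k.
    by apply: contraNneq (off 1) => ->; rewrite scale1r.
  by apply: (noncollinear_multiplier_eq _ off ej e ek); rewrite eq_sym (inj_eq inj_x).
have ne_off j k : (forall s, x k - x i0 != s *: (x j - x i0)) -> i0 != k.
  by move=> off; apply: contraNneq (off 0) => <-; rewrite subrr scale0r.
(* With direction 0, being off the line means being distinct from [x i0]. *)
have [j0 off0] := exists_off_line (x i0) 0 d2 span_x.
have ne_j0 : i0 != j0.
  by apply: contraNneq (off0 0) => <-; rewrite subrr scaler0.
have [lambda ej0] := par _ _ ne_j0; exists lambda => k.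
have [<-|ne_k] := eqVneq i0 k; first by rewrite !subrr scaler0.
have [mu ek] := par _ _ ne_k; rewrite ek; congr (_ *: _).
have [l offl] := exists_off_line (x i0) (x j0 - x i0) d2 span_x.
have [nu el] := par _ _ (ne_off _ _ offl).
have e_nu : lambda = nu by apply: (multiplier_eq j0 l) => //; rewrite eq_sym.
have [/sub_rVP [c]|off_k] :=
    boolP ((x k - x i0)^T <= (x j0 - x i0)^T)%MS; last first.
  apply/esym/(multiplier_eq j0 k) => //; first by rewrite eq_sym.
  by move=> s; apply: contraNneq off_k => ->; rewrite linearZ scalemx_sub.
(* As [x k] is on the line through [x i0] and [x j0], body [l] is also off the line through [x i0]
   and [x k]. *)
rewrite -linearZ => /trmx_inj on_k; rewrite e_nu; apply: (multiplier_eq k l) => //.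
  by rewrite eq_sym.
by move=> s; rewrite on_k scalerA.
Qed.

(** For [d = 1] there are [h + 1] bodies, too few for the [h + 2] distinct indices of an equation,
    so the system is empty; [hdh] then leaves the two-body case. *)
Theorem proposition4 (R : realType) (d h : nat) (a : R)
    (m : 'I_(d + h) -> R) (x : 'I_(d + h) -> 'cV[R]_d)
    (hd : (1 <= d)%N) (hh : (1 <= h)%N)
    (hdh : (2 <= d)%N \/ h = 1%N)
    (hm : forall i, m i != 0) (hM : total_mass m != 0)
    (hx : injective x) (hdim : affinely_spans x) :
  central_of_full_dim a m x <->
  (forall (i j : 'I_(d + h)) (l : 'I_h -> 'I_(d + h)),
     (i < j)%N ->
     (forall s t : 'I_h, (s < t)%N -> (l s < l t)%N) ->
     (forall t : 'I_h, l t != i /\ l t != j) ->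
     LauraAndoyer a m x i j l = 0).
Proof.
have lt0n : (0 < d + h)%N by rewrite addn_gt0 hd.
split=> [[cen _] i j l lt_ij l_incr l_ij|LA0].
  have ne_ij : i != j by apply: contraTneq lt_ij => ->; rewrite ltnn.
  have [lambda rel] := (central_accel a x i hM).1 cen.
  exact: (LauraAndoyer_of_parallel ne_ij (rel j)).
split=> //; pose i0 := Ordinal lt0n; apply/(central_accel a x i0 hM).
have [d2|d_lt2] := leqP 2 d.
  apply: common_multiplier => // i j ne_ij.
  (* The equations are given for [i < j]; exchanging the bodies negates both sides of the
     parallelism. *)
  wlog lt_ij : i j ne_ij / (i < j)%N.
    move=> IH; have [/IH|/IH|/val_inj e] := ltngtP i j; first exact.
      rewrite eq_sym => /(_ ne_ij) [lambda e]; exists lambda.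
      by rewrite -opprB e -scalerN opprB.
    by rewrite e eqxx in ne_ij.
  apply: parallel_of_LauraAndoyer => //; first by rewrite (inj_eq hx).
  by move=> l; exact: LA0.
have d1 : d = 1%N by apply/eqP; rewrite eqn_leq hd andbT.
case: hdh => [d2|h1]; first by rewrite leqNgt d_lt2 in d2.
(* Two bodies on a line remain: vectors have a single entry, and the multiplier is a quotient of
   entries. *)
subst d h; pose j0 : 'I_(1 + 1) := ord_max.
have x0 : (x i0 - x j0) 0 0 != 0.
  apply/eqP => e; have /hx // : x i0 = x j0.
  by apply/eqP; rewrite -subr_eq0; apply/eqP/matrixP => r c; rewrite !ord1 e mxE.
exists ((accel a m x i0 - accel a m x j0) 0 0 / (x i0 - x j0) 0 0) => j.
have [->|->] : j = i0 \/ j = j0.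
  by case: j => -[|[|//]] lt_j; [left | right]; apply: val_inj.
- by rewrite !subrr scaler0.
apply/matrixP => r c; rewrite !ord1 [RHS]mxE divfK //.
Qed.
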